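(* Let $\{u^{(k)}\}_{k\ge 0}$ be generated by the fixed-step iteration (Algorithm 1) $$u^{(k+1)}=\operatorname{prox}_{\chi}^{\mathsf H^k}\bigl(u^{(k)}-\gamma(\mathsf H^k)^{-1}\nabla F(u^{(k)})\bigr),$$ where $\gamma>0$ is such that every iterate has strictly positive $f$-component, and let $u^*$ be the unique minimizer of $F+\chi$. Fix $k$ and let $$G^k=\int_0^1\nabla^2F\bigl(u^*+s(u^{(k)}-u^* )\bigr)\,\mathrm ds .$$ Suppose there exist $0<\alpha<\beta$ such that $\alpha\mathsf I\preceq(\mathsf H^k)^{-1}G^k\preceq\beta\mathsf I$. Then $$\|u^{(k+1)}-u^*\|_{\mathsf H^k}\le C\,\|u^{(k)}-u^*\|_{\mathsf H^k},\qquad C=\max\bigl(|1-\gamma\alpha|,\,|\gamma\beta-1|\bigr).$$ In particular, if $\gamma=\frac{2}{\alpha+\beta}$, one has the optimal rate (the smallest value of $C$ over $\gamma>0$), $C=\frac{\beta-\alpha}{\beta+\alpha}$.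
   Context: Setting. Let $d\in\{1,2,3\}$, $N_v\ge 2$, $N=N_v^d$, $\varepsilon,\tau,\Delta v>0$, and let $M\in\mathbb R^N$ and $b\in\mathbb R^N$ be vectors with strictly positive entries. Write $u=[f;m]=[f;m_1;\dots;m_d]\in\mathbb R^{(d+1)N}$ with $f,m_1,\dots,m_d\in\mathbb R^N$, and $\|m\|_j^2=\sum_{l=1}^d m_{l,j}^2$. On the set $\{f>0\}$ (all entries of $f$ positive) let $$F(u)=\sum_{j=1}^N\Bigl(\varepsilon\frac{\|m\|_j^2}{f_j}+2\tau f_j\ln\frac{f_j}{M_j}\Bigr)(\Delta v)^d .$$ Let $\mathsf D_v\in\mathbb R^{N_v\times N_v}$ be $\frac1{2\Delta v}$ times the tridiagonal matrix with superdiagonal entries $1$, subdiagonal entries $-1$, and diagonal $(1,0,\dots,0,-1)$. Let $\mathsf A=(\mathsf I_N\ \ \mathsf A_1\ \cdots\ \mathsf A_d)$, where for $d=1$, $\mathsf A_1=\mathsf D_v$; for $d=2$, $\mathsf A_1=\mathsf I_{N_v}\otimes\mathsf D_v$, $\mathsf A_2=\mathsf D_v\otimes\mathsf I_{N_v}$; for $d=3$, $\mathsf A_1=\mathsf I_{N_v^2}\otimes\mathsf D_v$, $\mathsf A_2=\mathsf I_{N_v}\otimes(\mathsf D_v\otimes\mathsf I_{N_v})$, $\mathsf A_3=\mathsf D_v\otimes\mathsf I_{N_v^2}$. Let $\chi(u)=0$ if $\mathsf Au=b$ and $\chi(u)=+\infty$ otherwise. The minimizer $u^*$ of $F+\chi$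 is taken over $\{f>0\}$ (in particular its $f$-component is strictly positive). For a symmetric positive definite $\mathsf H$, $\|z\|_{\mathsf H}=\sqrt{z^{\intercal}\mathsf Hz}$ and $\operatorname{prox}_\chi^{\mathsf H}(u)=\operatorname{argmin}_{z:\,\mathsf Az=b}\tfrac12\|z-u\|_{\mathsf H}^2$. $\mathsf H^k$ is the diagonal matrix whose diagonal equals that of $\nabla^2F(u^{(k)})$ (it is positive definite when $f^{(k)}>0$). The iteration starts from $u^{(0)}=[b;0]$. Convention: $(\mathsf H^k)^{-1}G^k$ is similar to the symmetric matrix $(\mathsf H^k)^{-1/2}G^k(\mathsf H^k)^{-1/2}$, and $\alpha\mathsf I\preceq(\mathsf H^k)^{-1}G^k\preceq\beta\mathsf I$ means that all its (real) eigenvalues lie in $[\alpha,\beta]$. *)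

(* Defs.v *)
From HB Require Import structures.
From mathcomp Require Import all_boot all_order all_algebra.
From mathcomp Require Import mxtens.
From mathcomp Require Import all_classical all_reals all_analysis.
Set Implicit Arguments.
Unset Strict Implicit.
Unset Printing Implicit Defensive.
Import Order.TTheory GRing.Theory Num.Theory.
Import numFieldNormedType.Exports.
Local Open Scope classical_set_scope.
Local Open Scope ring_scope.

Definition argmin (T : Type) (disp : Order.disp_t) (V : porderType disp)
    (D : set T) (J : T -> V) : set T :=
  [set z | D z /\ forall w, D w -> (J z <= J w)%O].

(* R^{(d+1)N}, as column vectors made of d+1 stacked blocks of length N:
   block 0 is f, block l+1 is m_{l+1} (l = 0, ..., d-1). *)
Notation state R d N := 'cV[R]_(\sum_(l < d.+1) N) (only parsing).

Section Calculus.
Variables (R : realType) (n : nat).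
Implicit Types (J : 'cV[R]_n -> R) (x y z : 'cV[R]_n) (H : 'M[R]_n).

Definition unit_vec (i : 'I_n) : 'cV[R]_n := delta_mx i 0.

Definition grad J x : 'cV[R]_n := \col_i 'D_(unit_vec i) J x.

Definition hess J x : 'M[R]_n :=
  \matrix_(i, j) 'D_(unit_vec i) (fun y => 'D_(unit_vec j) J y) x.

Definition diag_part H : 'M[R]_n := diag_mx (\row_i H i i).

Definition mean_hess J x y : 'M[R]_n :=
  \matrix_(i, j)
    \int[@lebesgue_measure R]_(s in `[0, 1]) hess J (x + s *: (y - x)) i j.

Definition normH H z : R := Num.sqrt ((z^T *m H *m z) 0 0).

(* Used for matrices similar to a symmetric one, all of whose eigenvalues are
   real, so that quantifying over eigenvalues in R loses nothing. *)
Definition spectrum_in (alpha beta : R) (B : 'M[R]_n) : Prop :=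
  forall a : R, eigenvalue B a -> alpha <= a <= beta.

End Calculus.

Section Scheme.
Variable R : realType.

Section Functional.
Variables (d N : nat).

Definition fpart (u : state R d N) : 'cV[R]_N :=
  @submxcol R d.+1 (fun=> N) 1 u ord0.

Definition mpart (u : state R d N) (l : 'I_d) : 'cV[R]_N :=
  @submxcol R d.+1 (fun=> N) 1 u (lift ord0 l).

Definition pos_vec (v : 'cV[R]_N) : Prop := forall j, 0 < v j 0.

Definition fpos : set (state R d N) := [set u | pos_vec (fpart u)].

(* Only meaningful on [fpos]: outside it the values come from x / 0 = 0 and
   ln x = 0 for x <= 0. As [fpos] is open, [grad] and [hess] at its points do
   not see them. *)
Definition Fobj (eps tau dv : R) (M : 'cV[R]_N) (u : state R d N) : R :=
  \sum_(j < N)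
    (eps * ((\sum_(l < d) mpart u l j 0 ^+ 2) / fpart u j 0)
     + 2 * tau * fpart u j 0 * ln (fpart u j 0 / M j 0)) * dv ^+ d.

Definition init (b : 'cV[R]_N) : state R d N :=
  \mxcol_(l < d.+1) (if l == ord0 then b else 0).

End Functional.

Definition Dv (Nv : nat) (dv : R) : 'M[R]_Nv :=
  (2 * dv)^-1 *: \matrix_(i < Nv, j < Nv)
    (if j == i.+1 :> nat then 1
     else if i == j.+1 :> nat then -1
     else if (i == j) && (i == 0%N :> nat) then 1
     else if (i == j) && (i == Nv.-1 :> nat) then -1
     else 0).

(* The blocks A_1, ..., A_d, indexed from 0; [*t] is the Kronecker product.
   The value for d > 3 (and d = 0, where there is no block) is irrelevant. *)
Definition Ablock (d Nv : nat) (dv : R) : 'I_d -> 'M[R]_(Nv ^ d) :=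
  match d with
  | 1 => fun=> Dv Nv dv
  | 2 => fun l => if l == 0%N :> nat
                  then (1%:M : 'M[R]_Nv) *t Dv Nv dv
                  else Dv Nv dv *t (1%:M : 'M[R]_Nv)
  | 3 => fun l => if l == 0%N :> nat then
                    castmx (esym (expnSr Nv 2), esym (expnSr Nv 2))
                      ((1%:M : 'M[R]_(Nv ^ 2)) *t Dv Nv dv)
                  else if l == 1%N :> nat then
                    (1%:M : 'M[R]_Nv) *t (Dv Nv dv *t (1%:M : 'M[R]_Nv))
                  else Dv Nv dv *t (1%:M : 'M[R]_(Nv ^ 2))
  | _ => fun=> 0
  end.

Definition Amat (d Nv : nat) (dv : R) :
    'M[R]_(Nv ^ d, \sum_(l < d.+1) Nv ^ d) :=
  \mxrow_(l < d.+1) oapp (@Ablock d Nv dv) 1%:M (unlift ord0 l).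

Definition chi (p n : nat) (A : 'M[R]_(p, n)) (b : 'cV[R]_p) (u : 'cV[R]_n) :
    \bar R :=
  if A *m u == b then 0%E else +oo%E.

Definition prox_chi (p n : nat) (A : 'M[R]_(p, n)) (b : 'cV[R]_p)
    (H : 'M[R]_n) (u : 'cV[R]_n) : set 'cV[R]_n :=
  argmin [set z | A *m z = b] (fun z => 2^-1 * normH H (z - u) ^+ 2).

Definition rate (alpha beta gamma : R) : R :=
  Num.max `|1 - gamma * alpha| `|gamma * beta - 1|.

End Scheme.

(* Main.v *)
(* Write e = u^k - u_min, w = u^(k+1) - u_min, B(x, y) = x^T (H - gamma G) y and
   <x, y> = x^T H y, with H = H^k. Since u^(k+1) and u_min both satisfy the affine
   constraint, w lies in ker A. First-order optimality of the proximal step and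
   of u_min, both tested against w, together with G e = grad F(u^k) - grad F(u_min)
   (the fundamental theorem of calculus on the segment from u_min to u^k), give
   <w, w> = B(w, e). The spectral hypothesis says alpha <x, x> <= x^T G x
   <= beta <x, x>, hence |B(x, x)| <= C <x, x>, and polarization turns this into
   the Cauchy-Schwarz type bound |B(x, y)| <= C ||x|| ||y||. *)
Require Import Defs.
From HB Require Import structures.
From mathcomp Require Import all_boot all_order all_algebra.
From mathcomp Require Import all_classical all_reals all_analysis.
From mathcomp Require Import ring lra.
From mathcomp Require spectral complex.
Import Order.TTheory GRing.Theory Num.Theory.
Import numFieldNormedType.Exports.
Local Open Scope classical_set_scope.
Local Open Scope ring_scope.
Set Implicit Arguments.
Unset Strict Implicit.
Unset Printing Implicit Defensive.

(** * Nonnegative quadratic forms from the spectrum of a real symmetric matrix *)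

Section SpectralBound.
Import spectral complex.
Local Open Scope sesquilinear_scope.

(* Diagonalize over R[i], where the spectral theorem is available; the
   eigenvalues of a real symmetric matrix are real, so they come from R. *)
Lemma sym_quad_ge0 (R : rcfType) n (S : 'M[R]_n) (x : 'cV[R]_n) :
  S^T = S -> (forall a, eigenvalue S a -> 0 <= a) ->
  0 <= (x^T *m S *m x) 0 0.
Proof.
move=> symS eigS; pose f := real_complex R.
have SC_real : map_mx f S \is a mxOver Num.real.
  by apply/mxOverP => i j; rewrite mxE complex_real.
have herm : map_mx f S \is hermsymmx.
  apply: realsym_hermsym => //.
  by apply/is_hermitianmxP; rewrite expr0 scale1r map_mx_id // map_trmx symS.
have /orthomx_spectralP := hermitian_normalmx herm.
have /mxOverP := hermitian_spectral_diag_real herm.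
have := spectral_unitarymx (map_mx f S).
set P := spectralmx _; set D := spectral_diag _ => Pu Dreal SE.
have Punit : P \in unitmx by exact: unitarymx_unit.
have Dge0 i : 0 <= D 0 i.
  have /complex_realP[a Da] := Dreal 0 i.
  rewrite Da ler0c; apply: eigS.
  suff : eigenvalue (map_mx f S) (D 0 i) by rewrite Da eigenvalue_map.
  (* [eigenvalue] concerns row vectors: row [i] of [P] is a left eigenvector for [D 0 i], nonzero
     because [P] is invertible. *)
  apply/eigenvalueP; exists (row i P).
    rewrite SE -row_mul !mulmxA mulmxV // mul1mx.
    by rewrite row_mul row_diag_mx -scalemxAl -rowE.
  apply/negP => /eqP Pi0; have := mulmxV Punit => /(congr1 (row i)).
  rewrite row_mul Pi0 mul0mx => /rowP/(_ i); rewrite !mxE eqxx => /esym/eqP.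
  by rewrite oner_eq0.
(* In the coordinates [y] the form becomes the sum of [D 0 i] times the squared modulus of
   [y i 0]. *)
rewrite -ler0c; pose y := P *m map_mx f x.
have -> : ((x^T *m S *m x) 0 0)%:C%C = ((y ^t*) *m diag_mx D *m y) 0 0.
  have -> : y ^t* = map_mx f x^T *m invmx P.
    rewrite /y trmx_mul map_mxM invmx_unitary // map_trmx.
    apply: (congr1 (mulmx^~ _)); apply/matrixP => i j; rewrite !mxE.
    by apply/CrealP; rewrite complex_real.
  rewrite /y -!mulmxA [diag_mx D *m _]mulmxA.
  rewrite (mulmxA (invmx P)) (mulmxA (invmx P)) -SE.
  by rewrite -!map_mxM [RHS]mxE mulmxA.
rewrite -mulmxA mul_diag_mx mxE; apply: sumr_ge0 => i _.
by rewrite !mxE mulrCA mulr_ge0 // mulrC -normCK exprn_ge0.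
Qed.

End SpectralBound.

(** * Rules for directional derivatives *)

Section DirectionalDerivatives.
Variables (R : realType) (V : normedModType R).
Implicit Types (f g : V -> R) (x v : V).

(** Both sides have the same difference quotient. This is the bridge that carries one-variable
    results (chain rule, interior minimum, fundamental theorem) to directional derivatives. *)
Lemma is_derive_line f x v (s df : R) :
  is_derive s 1 (fun t => f (x + t *: v)) df <-> is_derive (x + s *: v) v f df.
Proof.
have E : (fun h : R => h^-1 *: (f (x + (h *: 1 + s) *: v) - f (x + s *: v))) =
         (fun h : R => h^-1 *: (f (h *: v + (x + s *: v)) - f (x + s *: v))).
  apply/funext => h; congr (_ *: (f _ - _)).
  by rewrite [h *: 1]mulr1 scalerDl addrCA.
by split=> -[]; rewrite /derivable /derive /= => dF lF; constructor;
  rewrite /derivable /derive /= ?E // -?E.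
Qed.

Lemma is_derive_scalar_comp (h : R -> R) f x v (dh df : R) :
  is_derive (f x) 1 h dh -> is_derive x v f df ->
  is_derive x v (h \o f) (dh * df).
Proof.
have x0 : x = x + (0 : R) *: v by rewrite scale0r addr0.
move=> hP fP; rewrite x0; apply/is_derive_line.
apply: (@is_derive1_comp _ h (fun t => f (x + t *: v))); first by rewrite -x0.
by apply/is_derive_line; rewrite -x0.
Qed.

Lemma is_derive_mul f g x v (df dg : R) :
  is_derive x v f df -> is_derive x v g dg ->
  is_derive x v (fun y => f y * g y) (f x * dg + g x * df).
Proof. exact: is_deriveM. Qed.

Lemma is_derive_add f g x v (df dg : R) :
  is_derive x v f df -> is_derive x v g dg ->
  is_derive x v (fun y => f y + g y) (df + dg).
Proof. exact: is_deriveD. Qed.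

Lemma is_derive_const (c : R) x v : is_derive x v (fun=> c) 0.
Proof. exact: is_derive_cst. Qed.

Lemma is_derive_bigsum n (h : 'I_n -> V -> R) x v (dh : 'I_n -> R) :
  (forall i, is_derive x v (h i) (dh i)) ->
  is_derive x v (fun y => \sum_(i < n) h i y) (\sum_(i < n) dh i).
Proof.
move=> dhP; rewrite (_ : (fun y => _) = \sum_(i < n) h i); last first.
  by apply/funext => y; rewrite fct_sumE.
exact: is_derive_sum.
Qed.

Lemma is_derive_inv f x v (df : R) : is_derive x v f df -> f x != 0 ->
  is_derive x v (fun y => (f y)^-1) (- (f x)^-1 ^+ 2 * df).
Proof.
move=> fP fx0; apply: (@is_derive_scalar_comp GRing.inv) fP.
have := @is_deriveV R id (f x) 1 1 fx0 (is_derive_id _ _).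
by rewrite [X in is_derive _ _ _ X]mulr1 exprVn.
Qed.

Lemma is_derive_ln f x v (df : R) : is_derive x v f df -> 0 < f x ->
  is_derive x v (fun y => ln (f y)) ((f x)^-1 * df).
Proof.
by move=> fP fx0; apply: is_derive_scalar_comp fP; exact: is_derive1_ln.
Qed.

Lemma is_derive_linear f x v : (forall a y z, f (a *: y + z) = a * f y + f z) ->
  is_derive x v f (f v).
Proof.
move=> flin.
have E : \forall h \near (0 : R)^',
    f v = h^-1 *: (f (h *: v + x) - f x).
  near=> h; rewrite flin addrK [_ *: _]mulKf //.
  by near: h; exact: nbhs_dnbhs_neq.
have C : (h^-1 *: (f (h *: v + x) - f x)) @[h --> (0 : R)^'] --> f v.
  by apply: cvg_trans; [apply: near_eq_cvg E|exact: cvg_cst].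
by constructor; [apply/cvg_ex; exists (f v)|exact: cvg_lim C].
Unshelve. all: end_near. Qed.

End DirectionalDerivatives.

(** Turns the entrywise definitions of [grad] and [mean_hess] into formulas along an arbitrary
    direction. *)
Lemma linear_sum_delta (R : realType) n (f : 'cV[R]_n -> R) (v : 'cV[R]_n) :
  (forall a y z, f (a *: y + z) = a * f y + f z) ->
  f v = \sum_(i < n) f (unit_vec R i) * v i 0.
Proof.
move=> flin.
have fD y z : f (y + z) = f y + f z by rewrite -[y]scale1r flin mul1r scale1r.
have f0 : f 0 = 0 by apply: (addrI (f 0)); rewrite -fD !addr0.
rewrite {1}(matrix_sum_delta v) (big_morph f fD f0); apply: eq_bigr => i _.
by rewrite big_ord1 -[_ *: _]addr0 flin f0 addr0 mulrC.
Qed.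

(** * Derivatives and strict convexity of the objective *)

Section Objective.
Variables (R : realType) (d N : nat) (eps tau dv : R) (M : 'cV[R]_N).
Implicit Types u v w : state R d N.

Notation fc u j := (fpart u j 0).
Notation mc u l j := (mpart u l j 0).
Notation F := (@Fobj R d N eps tau dv M).

Lemma fc_is_linear j (a : R) u v :
  fc (a *: u + v) j = a * fc u j + fc v j.
Proof. by rewrite /fpart !mxE. Qed.

Lemma mc_is_linear l j (a : R) u v :
  mc (a *: u + v) l j = a * mc u l j + mc v l j.
Proof. by rewrite /mpart !mxE. Qed.

Lemma state_eq0 u : (forall j, fc u j = 0) -> (forall l j, mc u l j = 0) ->
  u = 0.
Proof.
move=> fu mu; apply/mxcolP => l; apply/matrixP => j k; rewrite ord1 => {k}.
rewrite submxcol0 [RHS]mxE; case: (unliftP ord0 l) => [l' ->|->].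
  exact: mu.
exact: fu.
Qed.

(* First and second directional derivatives of [Fobj] on [fpos]. Each term of
   [d2Fobj] for [m^2 / f] is written as a product of two linear forms, which
   makes symmetry and positivity visible. *)
Definition dFobj v u : R :=
  \sum_(j < N)
    (eps * (\sum_(l < d)
       (2 * mc u l j * mc v l j * (fc u j)^-1
        - mc u l j ^+ 2 * (fc u j)^-1 ^+ 2 * fc v j))
     + 2 * tau * fc v j * (ln (fc u j / M j 0) + 1)) * dv ^+ d.

Definition d2Fobj v w u : R :=
  \sum_(j < N)
    (eps * (\sum_(l < d)
       2 * (mc w l j - mc u l j * (fc u j)^-1 * fc w j)
         * (mc v l j - mc u l j * (fc u j)^-1 * fc v j) * (fc u j)^-1)
     + 2 * tau * fc v j * fc w j * (fc u j)^-1) * dv ^+ d.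

Hypothesis M_gt0 : pos_vec M.

Let fcP j u v : is_derive u v (fun y : state R d N => fc y j) (fc v j).
Proof. by apply: is_derive_linear => a y z; exact: fc_is_linear. Qed.

Let mcP l j u v : is_derive u v (fun y : state R d N => mc y l j) (mc v l j).
Proof. by apply: is_derive_linear => a y z; exact: mc_is_linear. Qed.

Let lnP j u v : fpos u ->
  is_derive u v (fun y : state R d N => ln (fc y j / M j 0))
            ((fc u j)^-1 * fc v j).
Proof.
move=> u0; have Mj := M_gt0 j; have uj : 0 < fc u j := u0 j.
have quot_gt0 : 0 < fc u j / M j 0 by rewrite divr_gt0.
have qP := is_derive_mul (fcP j u v) (is_derive_const (M j 0)^-1 u v).
have P := is_derive_ln qP quot_gt0.
apply: is_derive_eq P _.
by field; rewrite !gt_eqF.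
Qed.

Lemma is_derive_Fobj u v : fpos u -> is_derive u v F (dFobj v u).
Proof.
move=> u0; rewrite /Fobj /dFobj.
apply: is_derive_bigsum => j; have uj : 0 < fc u j := u0 j.
have uj0 : fc u j != 0 by rewrite gt_eqF.
have iP := is_derive_inv (fcP j u v) uj0.
have cP := fun c : R => is_derive_const c u v.
have sP := is_derive_bigsum
  (fun l => is_derive_mul (mcP l j u v) (mcP l j u v)).
have P := is_derive_mul (is_derive_add
  (is_derive_mul (cP eps) (is_derive_mul sP iP))
  (is_derive_mul (is_derive_mul (cP (2 * tau)) (fcP j u v)) (lnP j v u0)))
  (cP (dv ^+ d)).
apply: is_derive_eq P _.
rewrite mulr0 add0r [LHS]mulrC; congr (_ * _); rewrite !mulr0 !addr0.
congr (_ + _); last by field.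
congr (_ * _); rewrite sumrB -!mulr_suml !mulrA addrC.
rewrite mulrN mulNr; congr (_ - _).
  by rewrite [LHS]mulrC; congr (_ * _); apply: eq_bigr => l _; ring.
by rewrite expr2 !mulrA; do 3 congr (_ * _); apply: eq_bigr.
Qed.

Lemma is_derive_dFobj u v w : fpos u -> is_derive u w (dFobj v) (d2Fobj v w u).
Proof.
move=> u0; rewrite /dFobj /d2Fobj.
apply: is_derive_bigsum => j; have uj : 0 < fc u j := u0 j.
have uj0 : fc u j != 0 by rewrite gt_eqF.
have iP := is_derive_inv (fcP j u w) uj0.
have cP := fun c : R => is_derive_const c u w.
have sP := is_derive_bigsum (fun l => is_deriveB
  (is_derive_mul (is_derive_mul (is_derive_mul (cP 2) (mcP l j u w))
    (cP (mc v l j))) iP)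
  (is_derive_mul (is_derive_mul (is_derive_mul (mcP l j u w) (mcP l j u w))
    (is_derive_mul iP iP)) (cP (fc v j)))).
have P := is_derive_mul (is_derive_add
  (is_derive_mul (cP eps) sP)
  (is_derive_mul (cP (2 * tau * fc v j))
    (is_derive_add (lnP j w u0) (cP 1))))
  (cP (dv ^+ d)).
apply: is_derive_eq P _.
rewrite mulr0 add0r [LHS]mulrC; congr (_ * _); rewrite !mulr0 !addr0.
congr (_ + _); last by field.
by congr (_ * _); apply: eq_bigr => l _; field.
Qed.

(** Serves to make second derivatives continuous along segments of [fpos], hence integrable
    there. *)
Lemma derivable_d2Fobj u v w z : fpos u -> derivable (d2Fobj v w) u z.
Proof.
move=> u0; rewrite /d2Fobj; apply: ex_derive.
apply: is_derive_bigsum => j; have uj : 0 < fc u j := u0 j.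
have uj0 : fc u j != 0 by rewrite gt_eqF.
have iP := is_derive_inv (fcP j u z) uj0.
have cP := fun c : R => is_derive_const c u z.
have qP l t := is_deriveB (cP (mc t l j))
  (is_derive_mul (is_derive_mul (mcP l j u z) iP) (cP (fc t j))).
have sP := is_derive_bigsum (fun l => is_derive_mul
  (is_derive_mul (is_derive_mul (cP 2) (qP l w)) (qP l v)) iP).
exact: is_derive_mul (is_derive_add (is_derive_mul (cP eps) sP)
  (is_derive_mul (cP (2 * tau * fc v j * fc w j)) iP)) (cP (dv ^+ d)).
Qed.

Lemma dFobj_is_linear u a v w :
  dFobj (a *: v + w) u = a * dFobj v u + dFobj w u.
Proof.
rewrite /dFobj mulr_sumr -big_split; apply: eq_bigr => j _ /=.
pose S z := \sum_(l < d) (2 * mc u l j * mc z l j * (fc u j)^-1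
                          - mc u l j ^+ 2 * (fc u j)^-1 ^+ 2 * fc z j).
rewrite -!/(S _) fc_is_linear (_ : S _ = a * S v + S w); first by ring.
rewrite /S mulr_sumr -big_split; apply: eq_bigr => l _ /=.
by rewrite fc_is_linear mc_is_linear; ring.
Qed.

Lemma d2Fobj_is_linear u z a v w :
  d2Fobj (a *: v + w) z u = a * d2Fobj v z u + d2Fobj w z u.
Proof.
rewrite /d2Fobj mulr_sumr -big_split; apply: eq_bigr => j _ /=.
pose S y := \sum_(l < d) 2 * (mc z l j - mc u l j * (fc u j)^-1 * fc z j)
              * (mc y l j - mc u l j * (fc u j)^-1 * fc y j) * (fc u j)^-1.
rewrite -!/(S _) fc_is_linear (_ : S _ = a * S v + S w); first by ring.
rewrite /S mulr_sumr -big_split; apply: eq_bigr => l _ /=.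
by rewrite fc_is_linear mc_is_linear; ring.
Qed.

Lemma d2FobjC u v w : d2Fobj v w u = d2Fobj w v u.
Proof.
rewrite /d2Fobj; apply: eq_bigr => j _; congr (_ * _); congr (_ + _); last ring.
by congr (_ * _); apply: eq_bigr => l _; ring.
Qed.

(** On the diagonal [v = w] every summand is a square with a nonnegative weight. If the sum
    vanishes, the entropy term kills the [f]-part of [v], after which the squares [q l j] reduce to
    those of its [m]-part. *)
Lemma d2Fobj_gt0 u v : 0 < eps -> 0 < tau -> 0 < dv -> fpos u -> v != 0 ->
  0 < d2Fobj v v u.
Proof.
move=> eps0 tau0 dv0 u0 v0.
pose q l j := mc v l j - mc u l j * (fc u j)^-1 * fc v j.
have E : d2Fobj v v u = \sum_(j < N)
    (eps * (\sum_(l < d) 2 * (q l j) ^+ 2 * (fc u j)^-1)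
     + 2 * tau * fc v j ^+ 2 * (fc u j)^-1) * dv ^+ d.
  rewrite /d2Fobj; apply: eq_bigr => j _; congr (_ * _); congr (_ + _); last ring.
  by congr (_ * _); apply: eq_bigr => l _; rewrite /q; ring.
have sq0 (c x : R) j : 0 <= c -> 0 <= c * x ^+ 2 * (fc u j)^-1.
  move=> c0; apply: mulr_ge0; first by rewrite mulr_ge0 ?sqr_ge0.
  by rewrite invr_ge0 ltW //; exact: u0.
have A0 j : 0 <= eps * (\sum_(l < d) 2 * (q l j) ^+ 2 * (fc u j)^-1).
  by apply: mulr_ge0; [exact: ltW|apply: sumr_ge0 => l _; exact: sq0].
have B0 j : 0 <= 2 * tau * fc v j ^+ 2 * (fc u j)^-1.
  by apply: sq0; rewrite mulr_ge0 // ltW.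
have dvd : 0 < dv ^+ d by rewrite exprn_gt0.
have T0 j : 'I_N -> 0 <= (eps * (\sum_(l < d) 2 * (q l j) ^+ 2 * (fc u j)^-1)
     + 2 * tau * fc v j ^+ 2 * (fc u j)^-1) * dv ^+ d.
  by move=> _; apply: mulr_ge0; [exact: addr_ge0|exact: ltW].
rewrite lt_neqAle E sumr_ge0 ?andbT; last by move=> j _; exact: T0.
rewrite eq_sym; apply: contra v0 => /eqP/psumr_eq0P Z.
have {}Z j : fc v j = 0 /\ forall l, q l j = 0.
  have uj : 0 < fc u j := u0 j.
  have := Z (fun j _ => T0 j j) j isT => /eqP.
  rewrite mulf_eq0 (gt_eqF dvd) orbF paddr_eq0 //.
  rewrite mulf_eq0 (gt_eqF eps0) /= => /andP[/eqP/psumr_eq0P qj].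
  rewrite !mulf_eq0 invr_eq0 (gt_eqF uj) (gt_eqF tau0) pnatr_eq0 /= orbF orbb.
  move=> /eqP fv; split=> // l; have := qj (fun l _ => sq0 _ _ _ (ler0n _ 2)) l isT.
  move=> /eqP; rewrite !mulf_eq0 invr_eq0 (gt_eqF uj) pnatr_eq0 /= orbF orbb.
  by move/eqP.
apply/eqP/state_eq0 => [j|l j]; first by case: (Z j).
by case: (Z j) => fv /(_ l); rewrite /q fv mulr0 subr0.
Qed.

(** Finitely many continuous coordinates stay positive. Openness along lines is what differentiating
    [grad] and varying around the minimizer require. *)
Lemma fpos_near_line u v : fpos u -> \forall t \near (0 : R), fpos (u + t *: v).
Proof.
move=> u0; suff : \forall t \near (0 : R), forall j, 0 < fc (u + t *: v) j by [].
apply: (@filter_forall _ _ (fun j t => 0 < fc (u + t *: v) j) (nbhs (0 : R)) _) => j.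
have /derivable1_diffP/differentiable_continuous C :
    derivable (fun t : R => fc (u + t *: v) j) 0 1.
  by have /is_derive_line[] := fcP j (u + (0 : R) *: v) v.
by apply: (cvgr_gt _ C); rewrite scale0r addr0; exact: u0.
Qed.

Lemma fpos_segment u v (s : R) : fpos u -> fpos v -> 0 <= s <= 1 ->
  fpos (u + s *: (v - u)).
Proof.
move=> u0 v0 /andP[s0 s1] j.
have uj : 0 < fc u j := u0 j; have vj : 0 < fc v j := v0 j.
have -> : u + s *: (v - u) = (1 - s) *: u + s *: v.
  by rewrite scalerBr scalerBl scale1r addrA addrAC.
rewrite fc_is_linear -[s *: v]addr0 fc_is_linear.
have -> : fc (0 : state R d N) j = 0 by rewrite /fpart submxcol0 mxE.
(* For [s != 0] the term in [v] is strictly positive; at [s = 0] strictness comes from [u]. *)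
rewrite addr0; have [->|s_neq0] := eqVneq s 0; first by rewrite subr0 mul1r mul0r addr0.
apply: ltr_wpDl; first by rewrite mulr_ge0 ?subr_ge0 // ltW.
by rewrite mulr_gt0 // lt_neqAle eq_sym s_neq0.
Qed.

Lemma gradFE u i : fpos u -> grad F u i 0 = dFobj (unit_vec R i) u.
Proof. by move=> u0; rewrite mxE; case: (is_derive_Fobj (unit_vec R i) u0). Qed.

Lemma hessFE u i j : fpos u ->
  hess F u i j = d2Fobj (unit_vec R j) (unit_vec R i) u.
Proof.
move=> u0; rewrite mxE; apply: derive_val.
have uE : u = u + (0 : R) *: unit_vec R i by rewrite scale0r addr0.
rewrite [X in is_derive X]uE; apply/is_derive_line => /=.
(* The closed form [dFobj] of the first derivative is valid on [fpos] only, so it replaces that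
   derivative just near [0] on the line. *)
apply: (@near_eq_is_derive R R^o R^o
  (fun t => dFobj (unit_vec R j) (u + t *: unit_vec R i))).
  near=> t; apply/esym; apply: derive_val; apply: is_derive_Fobj.
  by near: t; exact: fpos_near_line.
by apply/is_derive_line; rewrite -uE; exact: is_derive_dFobj.
Unshelve. all: end_near. Qed.

Lemma dot_gradF u w : fpos u -> (w^T *m grad F u) 0 0 = dFobj w u.
Proof.
move=> u0; rewrite (linear_sum_delta _ (dFobj_is_linear u)) mxE.
by apply: eq_bigr => i _; rewrite gradFE // mxE mulrC.
Qed.

(** * The Hessian averaged over a segment *)

Section MeanHessian.
Variables u v : state R d N.
Hypotheses (u_pos : fpos u) (v_pos : fpos v).

Let line (s : R) := u + s *: (v - u).

Let d2F_line_continuous z w :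
  {within `[0 : R, 1], continuous (fun s => d2Fobj z w (line s))}.
Proof.
apply: derivable_within_continuous => s; rewrite in_itv /= => s01.
have D : derivable (d2Fobj z w) (line s) (v - u).
  exact: derivable_d2Fobj (fpos_segment u_pos v_pos s01).
by have /derivableP/is_derive_line[] := D.
Qed.

Let d2F_line_integrable z w :
  (@lebesgue_measure R).-integrable `[0 : R, 1]
    (EFin \o (fun s => d2Fobj z w (line s))).
Proof.
apply: continuous_compact_integrable; first exact: segment_compact.
exact: d2F_line_continuous.
Qed.

Let mean_hessE i j : mean_hess F u v i j =
  \int[@lebesgue_measure R]_(s in `[0, 1])
     d2Fobj (unit_vec R j) (unit_vec R i) (line s).
Proof.
rewrite mxE; apply: eq_Rintegral => s; rewrite inE /= in_itv /= => s01.
by rewrite hessFE //; exact: fpos_segment.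
Qed.

Lemma mean_hess_sym : (mean_hess F u v)^T = mean_hess F u v.
Proof.
apply/matrixP => i j; rewrite mxE !mean_hessE; apply: eq_Rintegral => s _.
exact: d2FobjC.
Qed.

(** Row [i] is the fundamental theorem of calculus for the [i]-th partial derivative restricted to
    the segment. *)
Lemma mean_hess_mul : mean_hess F u v *m (v - u) = grad F v - grad F u.
Proof.
apply/colP => i; rewrite mxE.
have dF_line s : s \in `[0 : R, 1] ->
    is_derive s 1 (fun t : R => dFobj (unit_vec R i) (line t))
              (d2Fobj (unit_vec R i) (v - u) (line s)).
  rewrite in_itv /= => s01; apply/is_derive_line.
  exact: is_derive_dFobj (fpos_segment _ _ _).
have dF_cont s : s \in `[0 : R, 1] ->
    {for s, continuous (fun t : R => dFobj (unit_vec R i) (line t))}.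
  by move=> /dF_line[/derivable1_diffP/differentiable_continuous].
under eq_bigr do rewrite mean_hessE.
(* The sum over columns is the coordinate expansion of a linear form in [z], evaluated at [v - u];
   this moves the product inside the integral. *)
rewrite -(linear_sum_delta (f := fun z => \int[@lebesgue_measure R]_(s in `[0, 1])
     d2Fobj z (unit_vec R i) (line s))); last first.
  move=> a y z /=.
  rewrite -RintegralZl //.
  rewrite -RintegralD //.
  - by apply: eq_Rintegral => s _; exact: d2Fobj_is_linear.
  - by have := integrableZl (mu := @lebesgue_measure R) (measurable_itv _) a
      (d2F_line_integrable y (unit_vec R i)).
rewrite [RHS]mxE [X in _ = _ + X]mxE !gradFE // /Rintegral.
rewrite (@continuous_FTC2 _ _ (fun s => dFobj (unit_vec R i) (line s))) //.
- rewrite (_ : line 1 = v); last by rewrite /line scale1r addrC subrK.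
  by rewrite (_ : line 0 = u); last by rewrite /line scale0r addr0.
- split.
  + by move=> s /subset_itv_oo_cc s01; case: (dF_line _ s01).
  + apply: cvg_at_right_filter; apply: dF_cont; by rewrite in_itv /= lexx ler01.
  + apply: cvg_at_left_filter; apply: dF_cont; by rewrite in_itv /= lexx ler01.
(* Symmetry is used here: the integrand has [v - u] as first argument, the derivative along the line
   has it as second. *)
- by move=> s /subset_itv_oo_cc s01; rewrite derive1E d2FobjC; case: (dF_line _ s01).
Qed.

End MeanHessian.

End Objective.

(** * Contraction in the norm of a positive diagonal matrix *)

Definition bil (R : realType) n (K : 'M[R]_n) (x y : 'cV[R]_n) : R :=
  (x^T *m K *m y) 0 0.

Section Contraction.
Variables (R : realType) (n : nat).
Implicit Types (K : 'M[R]_n) (x y z : 'cV[R]_n).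

Lemma bilDr K x y z : bil K x (y + z) = bil K x y + bil K x z.
Proof. by rewrite /bil mulmxDr mxE. Qed.

Lemma bilZr K a x y : bil K x (a *: y) = a * bil K x y.
Proof. by rewrite /bil -scalemxAr mxE. Qed.

Lemma bilC K x y : K^T = K -> bil K x y = bil K y x.
Proof.
move=> symK; rewrite /bil.
have -> : y^T *m K *m x = (x^T *m K *m y)^T.
  by rewrite !trmx_mul trmxK symK mulmxA.
by rewrite [RHS]mxE.
Qed.

Lemma bilDl K x y z : bil K (x + y) z = bil K x z + bil K y z.
Proof. by rewrite /bil linearD /= !mulmxDl mxE. Qed.

Lemma bilZl K a x y : bil K (a *: x) y = a * bil K x y.
Proof. by rewrite /bil linearZ /= -!scalemxAl mxE. Qed.

Lemma bilB K K' x y : bil (K - K') x y = bil K x y - bil K' x y.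
Proof. by rewrite /bil mulmxBr mulmxBl !mxE. Qed.

Lemma bilM K a x y : bil (a *: K) x y = a * bil K x y.
Proof. by rewrite /bil -scalemxAr -scalemxAl mxE. Qed.

Lemma bil_sqrD K t x y : K^T = K ->
  bil K (x + t *: y) (x + t *: y)
    = bil K x x + 2 * t * bil K x y + t ^+ 2 * bil K y y.
Proof.
by move=> symK; rewrite !bilDr !bilDl !bilZr !bilZl (bilC y x symK); ring.
Qed.

Variable h : 'rV[R]_n.
Hypothesis h_gt0 : forall i, 0 < h 0 i.
Local Notation H := (diag_mx h).

(** The diagonals of [H^(-1/2)] here and of [H^(1/2)] in [s]. *)
Let r : 'rV[R]_n := map_mx (fun a => (Num.sqrt a)^-1) h.
Let s : 'rV[R]_n := map_mx Num.sqrt h.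

Let rs : diag_mx r *m diag_mx s = 1%:M.
Proof.
apply/matrixP => i j; rewrite mul_diag_mx !mxE.
by have [->|] := eqVneq i j; rewrite ?mulr0 // mulVf // gt_eqF // sqrtr_gt0.
Qed.

Let sr : diag_mx s *m diag_mx r = 1%:M.
Proof. by rewrite diag_mxC rs. Qed.

Let ss : diag_mx s *m diag_mx s = H.
Proof.
apply/matrixP => i j; rewrite mul_diag_mx !mxE.
by have [->|] := eqVneq i j; rewrite ?mulr0 // -expr2 sqr_sqrtr // ltW.
Qed.

Lemma diag_mx_pos_unit : H \in unitmx.
Proof.
by rewrite -ss unitmx_mul; have [_ ->] := mulmx1_unit rs.
Qed.

Let rr : invmx H = diag_mx r *m diag_mx r.
Proof.
rewrite -[RHS](mulKmx diag_mx_pos_unit) -[LHS]mulmx1; congr (_ *m _).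
by rewrite -ss -mulmxA (mulmxA (diag_mx s) (diag_mx r)) sr mul1mx.
Qed.

Lemma bil_diag_ge0 x : 0 <= bil H x x.
Proof.
rewrite /bil -mulmxA mul_diag_mx mxE; apply: sumr_ge0 => i _.
by rewrite !mxE mulrCA -expr2 mulr_ge0 ?sqr_ge0 // ltW.
Qed.

Lemma normH_diag_sqr x : normH H x ^+ 2 = bil H x x.
Proof. by rewrite sqr_sqrtr // bil_diag_ge0. Qed.

(* [invmx H *m K] is similar to the symmetric [H^(-1/2) K H^(-1/2)]. *)
Lemma pencil_quad_ge0 K x : K^T = K ->
  (forall a, eigenvalue (invmx H *m K) a -> 0 <= a) -> 0 <= bil K x x.
Proof.
move=> symK eigK; pose S := diag_mx r *m K *m diag_mx r.
have symS : S^T = S by rewrite /S !trmx_mul tr_diag_mx symK mulmxA.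
have KE : K = diag_mx s *m S *m diag_mx s.
  by rewrite /S !mulmxA sr mul1mx -!mulmxA rs mulmx1.
have -> : bil K x x = bil S (diag_mx s *m x) (diag_mx s *m x).
  by rewrite /bil trmx_mul tr_diag_mx {1}KE !mulmxA.
(* Multiplying a left eigenvector of [S] by [H^(1/2)] on the right gives one of [invmx H *m K]. *)
apply: sym_quad_ge0 => // a /eigenvalueP[v vS v0]; apply: eigK.
apply/eigenvalueP; exists (v *m diag_mx s).
  rewrite rr !mulmxA -(mulmxA v) sr mulmx1 scalemxAl -vS /S !mulmxA.
  by rewrite -[RHS]mulmxA rs mulmx1.
by apply: contra v0 => /eqP v0; rewrite -[v]mulmx1 -sr mulmxA v0 mul0mx.
Qed.

(** Apply [pencil_quad_ge0] to [G - alpha H] and [beta H - G]: premultiplied by [invmx H], these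
    have as eigenvalues those of [invmx H *m G] shifted by [alpha], respectively subtracted from
    [beta]. *)
Lemma spectrum_in_quad (alpha beta : R) G x : G^T = G ->
  spectrum_in alpha beta (invmx H *m G) ->
  alpha * bil H x x <= bil G x x <= beta * bil H x x.
Proof.
move=> symG spec.
rewrite -subr_ge0 -bilM -bilB -[X in _ && X]subr_ge0 -bilM -bilB.
apply/andP; split; apply: pencil_quad_ge0.
- by rewrite linearB /= linearZ /= tr_diag_mx symG.
- move=> a /eigenvalueP[v vK v0]; rewrite -(lerD2r alpha) add0r.
  suff /spec/andP[] : eigenvalue (invmx H *m G) (a + alpha) by [].
  apply/eigenvalueP; exists v => //; rewrite scalerDl -vK.
  by rewrite mulmxBr -scalemxAr mulVmx ?diag_mx_pos_unit // mulmxBr -scalemxAr mulmx1 subrK.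
- by rewrite linearB /= linearZ /= tr_diag_mx symG.
- move=> a /eigenvalueP[v vK v0]; rewrite -(lerD2l (beta - a)) addr0 subrK.
  suff /spec/andP[] : eigenvalue (invmx H *m G) (beta - a) by [].
  apply/eigenvalueP; exists v => //; rewrite scalerBl -vK.
  rewrite mulmxBr -scalemxAr mulVmx ?diag_mx_pos_unit // mulmxBr -scalemxAr mulmx1 opprB.
  by rewrite addrC subrK.
Qed.

Lemma rate_ge0 (alpha beta gamma : R) : 0 <= rate alpha beta gamma.
Proof. by rewrite /rate le_max normr_ge0. Qed.

(** The form lies between [1 - gamma * beta] and [1 - gamma * alpha] times [bil H x x]; [rate]
    dominates the second factor and the opposite of the first. *)
Lemma rate_quad (alpha beta gamma : R) G x : 0 < gamma -> G^T = G ->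
  spectrum_in alpha beta (invmx H *m G) ->
  `|bil (H - gamma *: G) x x| <= rate alpha beta gamma * bil H x x.
Proof.
move=> gamma0 symG spec; have /andP[lo hi] := spectrum_in_quad x symG spec.
have q0 := bil_diag_ge0 x; rewrite bilB bilM ler_norml; apply/andP; split.
  have : gamma * beta - 1 <= rate alpha beta gamma.
    by rewrite /rate le_max; apply/orP; right; exact: ler_norm.
  move=> /(ler_wpM2r q0); have := ler_wpM2l (ltW gamma0) hi; lra.
have : 1 - gamma * alpha <= rate alpha beta gamma.
  by rewrite /rate le_max; apply/orP; left; exact: ler_norm.
by move=> /(ler_wpM2r q0); have := ler_wpM2l (ltW gamma0) lo; lra.
Qed.

Lemma contraction_of_identity (alpha beta gamma : R) G x y :
  0 < gamma -> G^T = G -> spectrum_in alpha beta (invmx H *m G) ->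
  bil H x x = bil (H - gamma *: G) x y ->
  normH H x <= rate alpha beta gamma * normH H y.
Proof.
move=> gamma0 symG spec xyE; set C := rate _ _ _; set K := H - _ in xyE.
have C0 : 0 <= C := rate_ge0 _ _ _.
have symH : H^T = H := tr_diag_mx h.
have symK : K^T = K by rewrite /K linearB /= linearZ /= symH symG.
have x2 := normH_diag_sqr x; have y2 := normH_diag_sqr y.
set a := normH H x in x2 *; set c := normH H y in y2 *.
have a0 : 0 <= a by exact: sqrtr_ge0.
have c0 : 0 <= c by exact: sqrtr_ge0.
(* Polarization: [4 t B(x, y) = B(x + t y, x + t y) - B(x - t y, x - t y)]. *)
have polar t : 2 * t * a ^+ 2 <= C * (a ^+ 2 + t ^+ 2 * c ^+ 2).
  have := rate_quad (x + t *: y) gamma0 symG spec.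
  have := rate_quad (x + (- t) *: y) gamma0 symG spec.
  rewrite -/K -/C !bil_sqrD // -xyE -x2 -y2 !ler_norml.
  by move=> /andP[? _] /andP[_ ?]; lra.
have [c_eq0|c_neq0] := eqVneq c 0.
  (* With [c = 0], the choice [t = C + 1] yields [(C + 2) * a ^+ 2 <= 0], so [a = 0]. *)
  have := polar (C + 1); rewrite c_eq0 mulr0; nra.
(* This [t] balances the two terms on the right, leaving
   [2 * (a / c) * a ^+ 2 <= 2 * C * a ^+ 2]. *)
have := polar (a / c); rewrite expr_div_n divfK ?expf_neq0 // => P.
have [->|a_neq0] := eqVneq a 0; first by rewrite mulr_ge0.
have c_gt0 : 0 < c by rewrite lt_neqAle eq_sym c_neq0.
have a_gt0 : 0 < a by rewrite lt_neqAle eq_sym a_neq0.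
rewrite -ler_pdivrMr // -(ler_pM2r (exprn_gt0 2 a_gt0)); lra.
Qed.

(** Moving [z] by [t *: w] keeps it feasible, so [2 * t * B + t ^+ 2 * Q] is nonnegative for all
    [t], which forces the linear coefficient [B] to vanish. *)
Lemma prox_chi_orthogonal p (A : 'M[R]_(p, n)) b v z w :
  prox_chi A b H v z -> A *m w = 0 -> bil H (z - v) w = 0.
Proof.
move=> [/= Az zmin] Aw.
have symH : H^T = H := tr_diag_mx h.
have q0 := bil_diag_ge0 w.
pose B := bil H (z - v) w; pose Q := bil H w w.
have var t : 0 <= 2 * t * B + t ^+ 2 * Q.
  have := zmin (z + t *: w); rewrite /= mulmxDr Az -scalemxAr Aw scaler0 addr0.
  move=> /(_ erefl); rewrite addrAC !normH_diag_sqr bil_sqrD // -/B -/Q; lra.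
have Q1 : 0 < Q + 1 by rewrite ltr_wpDl.
(* The minimizing [t] would be [- B / Q]; the denominator [Q + 1] also covers [Q = 0] and still
   gives a negative value unless [B = 0]. *)
have := var (- B / (Q + 1)).
have -> : 2 * (- B / (Q + 1)) * B + (- B / (Q + 1)) ^+ 2 * Q =
          - ((B / (Q + 1)) ^+ 2 * (Q + 2)).
  by field; rewrite gt_eqF.
rewrite oppr_ge0 => le0; apply/eqP; rewrite -/B.
have : (B / (Q + 1)) ^+ 2 * (Q + 2) == 0.
  by rewrite eq_le le0 mulr_ge0 ?sqr_ge0 // addr_ge0.
rewrite mulf_eq0 expf_eq0 /= mulf_eq0 invr_eq0 (gt_eqF Q1) orbF.
by case/orP => [//|/eqP Q2]; move: q0; rewrite -/Q; lra.
Qed.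

End Contraction.

(** At this step size the two terms of the maximum coincide. *)
Lemma rate_opt (R : realType) (alpha beta : R) : 0 < alpha -> alpha < beta ->
  rate alpha beta (2 / (alpha + beta)) = (beta - alpha) / (beta + alpha).
Proof.
move=> alpha0 ab; have s0 : alpha + beta != 0 by rewrite gt_eqF //; lra.
have s1 : beta + alpha != 0 by rewrite addrC.
have q0 : 0 <= (beta - alpha) / (beta + alpha) by apply: divr_ge0; lra.
rewrite /rate (_ : 1 - _ = (beta - alpha) / (beta + alpha)); last first.
  by field; rewrite ?s0 ?s1.
rewrite (_ : _ - 1 = (beta - alpha) / (beta + alpha)); last first.
  by field; rewrite ?s0 ?s1.
by rewrite maxxx ger0_norm.
Qed.

(** In [beta * (1 - gamma * alpha) + alpha * (gamma * beta - 1)] the step size cancels and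
    [beta - alpha] remains, while each bracket is at most the rate. *)
Lemma rate_lower (R : realType) (alpha beta gamma : R) :
  0 < alpha -> alpha < beta ->
  (beta - alpha) / (beta + alpha) <= rate alpha beta gamma.
Proof.
move=> alpha0 ab; rewrite ler_pdivrMr; last by lra.
have : 1 - gamma * alpha <= rate alpha beta gamma.
  by rewrite /rate le_max; apply/orP; left; exact: ler_norm.
have : gamma * beta - 1 <= rate alpha beta gamma.
  by rewrite /rate le_max; apply/orP; right; exact: ler_norm.
nra.
Qed.

(** * First-order optimality of the constrained minimizer *)

Section Optimality.
Variables (R : realType) (d N : nat) (eps tau dv : R) (M : 'cV[R]_N).
Hypothesis M_gt0 : pos_vec M.
Notation F := (@Fobj R d N eps tau dv M).

(** The feasible [v] has a finite value, so the minimal value cannot be [+oo]. *)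
Lemma feasible_argmin p (A : 'M[R]_(p, _)) b (us v : state R d N) :
  argmin (@fpos R d N) (fun w => (F w)%:E + chi A b w)%E us ->
  fpos v -> A *m v = b -> A *m us = b.
Proof.
move=> [_ /(_ v)] + v0 Av => /(_ v0); rewrite /chi Av eqxx adde0.
by case: eqP => // _; rewrite addey // leye_eq.
Qed.

(** On the line through [us] in direction [w], [chi] is zero, so [F] restricted to a short piece of
    it has an interior minimum at [t = 0]. *)
Lemma grad_argmin_ker p (A : 'M[R]_(p, _)) b (us w : state R d N) :
  argmin (@fpos R d N) (fun w => (F w)%:E + chi A b w)%E us ->
  A *m us = b -> A *m w = 0 -> (w^T *m grad F us) 0 0 = 0.
Proof.
move=> [us0 us_min] Aus Aw; rewrite (dot_gradF eps tau dv M_gt0) //.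
have [e /= e0 near_pos] := fpos_near_line w us0.
have pos t : t \in `]- e, e[ -> fpos (us + t *: w).
  by rewrite in_itv /= -ltr_norml => te; apply: near_pos; rewrite /= sub0r normrN.
have D t : t \in `]- e, e[ ->
    is_derive t 1 (fun s : R => F (us + s *: w))
              (dFobj eps tau dv M w (us + t *: w)).
  by move=> /pos tpos; apply/is_derive_line; exact: is_derive_Fobj.
have e_in : (0 : R) \in `]- e, e[ by rewrite in_itv /= oppr_lt0 e0.
have [_ min0] : is_derive (0 : R) 1 (fun s : R => F (us + s *: w)) 0.
  apply: (@derive1_at_min _ _ (- e) e) => //.
  - by rewrite ge0_cp // ltW.
  - by move=> t /D[].
  move=> t /pos tpos; rewrite scale0r addr0.
  have := us_min _ tpos; rewrite /chi mulmxDr -scalemxAr Aw scaler0 addr0 Aus eqxx.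
  by rewrite !adde0 lee_fin.
by have [_] := D _ e_in; rewrite min0 scale0r addr0.
Qed.

End Optimality.

(** * One-step contraction of the iteration and the optimal step size *)

Theorem theorem3p2 (R : realType) (d Nv : nat) (hd : d \in [:: 1; 2; 3]%N)
    (hNv : (2 <= Nv)%N) (eps tau dv : R) (heps : 0 < eps) (htau : 0 < tau)
    (hdv : 0 < dv) (M b : 'cV[R]_(Nv ^ d)) (hM : pos_vec M) (hb : pos_vec b)
    (F : state R d (Nv ^ d) -> R) (hF : F = Fobj eps tau dv M)
    (A : 'M[R]_(Nv ^ d, \sum_(l < d.+1) Nv ^ d)) (hA : A = Amat d Nv dv)
    (gamma : R) (hgamma : 0 < gamma)
    (u : nat -> state R d (Nv ^ d)) (H : nat -> 'M[R]_(\sum_(l < d.+1) Nv ^ d))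
    (hH : forall k, H k = diag_part (hess F (u k)))
    (hu0 : u 0%N = init d b)
    (huS : forall k, prox_chi A b (H k)
                       (u k - gamma *: (invmx (H k) *m grad F (u k))) (u k.+1))
    (hpos : forall k, fpos (u k))
    (us : state R d (Nv ^ d))
    (hus : argmin (@fpos R d (Nv ^ d)) (fun v => (F v)%:E + chi A b v)%E
           = [set us])
    (k : nat) (G : 'M[R]_(\sum_(l < d.+1) Nv ^ d))
    (hG : G = mean_hess F us (u k))
    (alpha beta : R) (halpha : 0 < alpha) (hab : alpha < beta)
    (hspec : spectrum_in alpha beta (invmx (H k) *m G)) :
  normH (H k) (u k.+1 - us) <= rate alpha beta gamma * normH (H k) (u k - us)
  /\ (gamma = 2 / (alpha + beta) ->
      [/\ rate alpha beta gamma = (beta - alpha) / (beta + alpha),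
          forall gamma' : R, 0 < gamma' ->
            rate alpha beta gamma <= rate alpha beta gamma'
        & normH (H k) (u k.+1 - us)
            <= (beta - alpha) / (beta + alpha) * normH (H k) (u k - us)]).

Proof.
have us_min : argmin (@fpos R d (Nv ^ d)) (fun v => (F v)%:E + chi A b v)%E us.
  by rewrite hus.
pose h k : 'rV[R]_(\sum_(l < d.+1) Nv ^ d) := \row_i hess F (u k) i i.
(* A diagonal Hessian entry is [d2Fobj] on a unit vector taken twice, hence positive by
   definiteness. *)
have h_gt0 j i : 0 < h j 0 i.
  rewrite mxE hF (hessFE _ _ _ hM) //; apply: d2Fobj_gt0 => //.
  by apply/eqP => /colP/(_ i)/eqP; rewrite !mxE !eqxx oner_eq0.
have HE j : H j = diag_mx (h j) by rewrite hH.
have prox j := huS j; rewrite HE in hspec *.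
have Au j : A *m u j.+1 = b by case: (prox j).
have Aus : A *m us = b.
  (* The feasible comparison point is [u 1], which satisfies the constraint as the output of a
     proximal step. *)
  by move: us_min; rewrite hF => /feasible_argmin; apply; [exact: hpos 1%N|exact: Au].
pose w := u k.+1 - us; pose e := u k - us.
have Aw : A *m w = 0 by rewrite mulmxBr Au Aus subrr.
have us_pos : fpos us by case: us_min.
have G_sym : G^T = G by rewrite hG hF; exact: mean_hess_sym.
have Ge : G *m e = grad F (u k) - grad F us by rewrite hG hF; exact: mean_hess_mul.
have H_unit := diag_mx_pos_unit (h_gt0 k).
have opt : (w^T *m grad F us) 0 0 = 0.
  by rewrite hF in us_min *; exact: grad_argmin_ker us_min Aus Aw.
have Gw : bil G w e = (w^T *m grad F (u k)) 0 0.
  by rewrite /bil -mulmxA Ge mulmxBr [LHS]mxE [X in _ + X]mxE opt subr0.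
have Hw : bil (diag_mx (h k)) w (invmx (diag_mx (h k)) *m grad F (u k))
          = bil G w e.
  by rewrite Gw /bil -mulmxA mulKVmx.
(* Orthogonality of the proximal residual to [w] reads [<w - e + gamma * H^(-1) grad F(u k), w> =
   0]; by [Hw] its gradient part is [gamma * bil G w e]. *)
have step :
    bil (diag_mx (h k)) w w = bil (diag_mx (h k) - gamma *: G) w e.
  have := prox k; rewrite HE => /(prox_chi_orthogonal (h_gt0 k))/(_ Aw).
  rewrite bilC ?tr_diag_mx // opprB addrA addrAC.
  have -> : u k.+1 - u k = w + (-1) *: e.
    by rewrite scaleN1r /w /e opprB addrA subrK.
  rewrite 2!bilDr !bilZr Hw bilB bilM; lra.
have main :
    normH (diag_mx (h k)) w <= rate alpha beta gamma * normH (diag_mx (h k)) e.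
  exact: contraction_of_identity step.
split=> // gammaE; have rE := rate_opt halpha hab.
rewrite gammaE rE in main *; split=> // gamma' _.
exact: rate_lower.
Qed.
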